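(* Let $\{X_n\}_{n\ge 0}$ be the $(2,1)$-reflecting random walk on $\mathbb{Z}^+=\{0,1,2,\ldots\}$ with parameters $(p(i),q_1(i),q_2(i))_{i\ge 1}$, and let $M_k$ ($k\ge1$) be the associated $2\times 2$ matrices. Let $$\kappa:=\sum_{k=1}^{\infty} e_1 M_kM_{k-1}\cdots M_1u .$$ If $\kappa=\infty$, then the walk $\{X_n\}_{n\ge 0}$ is recurrent.
   Context: The $(2,1)$-reflecting random walk is the Markov chain $\{X_n\}_{n\ge0}$ on $\mathbb{Z}^+=\{0,1,2,\ldots\}$ with $X_0=0$ and the following transition probabilities. For each $i\ge1$ we are given $q_1(i),q_2(i)\ge 0$ and $0<p(i)<1$ with $q_1(i)+q_2(i)+p(i)=1$. Then $P_{01}=p(0)=1$; $P_{12}=p(1)$ and $P_{10}=q_1(1)+q_2(1)$; and for $i\ge2$, $P_{i,i+1}=p(i)$, $P_{i,i-1}=q_1(i)$, $P_{i,i-2}=q_2(i)$; all other transition probabilities are $0$. The chain is irreducible. Notation: $e_1=(1,0)$, $e_2=(0,1)$ are row vectors, $u=e_1'+e_2'=(1,1)'$ is a column vector (prime denotes transpose), and $$M_1=\begin{pmatrix}\frac{q_1(1)+q_2(1)}{p(1)}&0\\ \frac1{p(1)}&0\end{pmatrix},\qquad M_i=\begin{pmatrix}\frac{q_1(i)}{p(i)}&\frac{q_2(i)}{p(i)}\\ 1+\frac{q_1(i)}{p(i)}&\frac{q_2(i)}{p(i)}\end{pmatrix},\quad i>1.$$ *)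

(* Defs.v *)
From mathcomp Require Import all_boot all_order all_algebra.
From mathcomp Require Import all_classical all_reals all_analysis.

Set Implicit Arguments.
Unset Strict Implicit.
Unset Printing Implicit Defensive.

Import Order.TTheory GRing.Theory Num.Theory.

Local Open Scope classical_set_scope.
Local Open Scope ring_scope.

(* Elementary conditional probability P(A | B); only meaningful if P B != 0. *)
Definition cond_pr (d : measure_display) (T : measurableType d) (R : realType)
    (P : probability T R) (A B : set T) : R :=
  fine (P (A `&` B)) / fine (P B).

Definition markov_chain (d : measure_display) (T : measurableType d)
    (R : realType) (P : probability T R) (X : nat -> {RV P >-> nat})
    (i0 : nat) (Q : nat -> nat -> R) : Prop :=
  P [set t | X 0%N t = i0] = 1%E /\
  forall (n : nat) (x : nat -> nat) (j : nat),
    let past := [set t | forall k : nat, (k <= n)%N -> X k t = x k] in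
    (0 < P past)%E -> cond_pr P [set t | X n.+1 t = j] past = Q (x n) j.

(* For a homogeneous Markov chain, conditioning on [X m = i] at any time m at
   which i can be occupied amounts to starting the chain afresh from i. *)
Definition recurrent_state (d : measure_display) (T : measurableType d)
    (R : realType) (P : probability T R) (X : nat -> {RV P >-> nat})
    (i : nat) : Prop :=
  forall m : nat, (0 < P [set t | X m t = i])%E ->
    cond_pr P [set t | exists2 n : nat, (0 < n)%N & X (m + n)%N t = i]
              [set t | X m t = i] = 1.

Definition recurrent (d : measure_display) (T : measurableType d)
    (R : realType) (P : probability T R) (X : nat -> {RV P >-> nat}) : Prop :=
  forall i : nat, recurrent_state X i.

Section Walk21.
Variables (R : realType) (p q1 q2 : nat -> R).

(* The values of p, q1, q2 at 0 are never used. *)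
Definition params21 : Prop :=
  forall i : nat, (1 <= i)%N ->
    [/\ 0 <= q1 i, 0 <= q2 i, 0 < p i < 1 & q1 i + q2 i + p i = 1].

Definition trans21 (i j : nat) : R :=
  match i with
  | 0 => if j == 1%N then 1 else 0
  | 1 => if j == 2%N then p 1%N
         else if j == 0%N then q1 1%N + q2 1%N else 0
  | _ => if j == i.+1 then p i
         else if j == i.-1 then q1 i
         else if j == i.-2 then q2 i else 0
  end.

Definition reflecting_walk21 (d : measure_display) (T : measurableType d)
    (P : probability T R) (X : nat -> {RV P >-> nat}) : Prop :=
  markov_chain X 0 trans21.

Definition mx2 (a b c e : R) : 'M[R]_2 :=
  \matrix_(i < 2, j < 2)
    if i == 0 then (if j == 0 then a else b) else (if j == 0 then c else e).

Definition walkM (i : nat) : 'M[R]_2 :=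
  if i == 1%N then
    mx2 ((q1 1%N + q2 1%N) / p 1%N) 0
        (1 / p 1%N)                 0
  else
    mx2 (q1 i / p i)     (q2 i / p i)
        (1 + q1 i / p i) (q2 i / p i).

(* M_k M_(k-1) ... M_1, in this order. *)
Definition walkMprod (k : nat) : 'M[R]_2 := \prod_(0 <= j < k) walkM (k - j).

Definition vec_e1 : 'rV[R]_2 := delta_mx 0 0.
Definition vec_e2 : 'rV[R]_2 := delta_mx 0 1.
Definition vec_u : 'cV[R]_2 := vec_e1^T + vec_e2^T.

Definition kappa : \bar R :=
  (\sum_(1 <= k <oo) ((vec_e1 *m walkMprod k *m vec_u) 0 0)%:E)%E.

End Walk21.

(* Main.v *)
Require Import Defs.
From mathcomp Require Import all_boot all_order all_algebra.
From mathcomp Require Import all_classical all_reals all_analysis.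
From mathcomp Require Import ring lra zify.

(** The term e_1 M_k ... M_1 u of kappa is the increment h(k+1) - h(k) of the
    function h with h(0) = 0 and h(1) = 1 that is harmonic for the walk at every
    state other than 0 ([hincr1] and [hincrS]).  These increments are positive,
    so kappa = oo says that h increases to infinity.

    Such an h forces every bounded subharmonic function w to be constant.  The
    recursion of the increments of h holds as an inequality for the increments
    of w, and its coefficients are nonnegative.  So if two consecutive
    increments of w are at least c times those of h, then this stays true at all
    higher states, and w would be unbounded if c > 0 ([bounded_subharmonic_incr]).
    Started at 0, this gives w(1) <= w(0), hence w(1) = w(0) because
    subharmonicity at 0 reads w(0) <= w(1).  It follows that w is nondecreasing.
    Started at the position of a positive increment of w, it then gives a
    contradiction ([bounded_subharmonic_const]).

    Recurrence follows from this Liouville property.  Let u(j) be the limit of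
    the probability of avoiding i for n steps when starting from j.  The function
    equal to u off i and to 0 at i is bounded and subharmonic, hence constant,
    hence 0; a last step from i gives u(i) = 0 ([avoid_cvg0]).  The Markov
    property bounds the probability of following a given path up to time m and
    then avoiding i for n steps by the probability of the path times the
    probability of avoiding i for n steps ([past_avoids_le]).  The event that the
    chain is at i at time m and never returns is a countable union, over paths
    up to time m, of events that are null by this bound
    ([recurrent_state_of_avoid]). *)

Set Implicit Arguments.
Unset Strict Implicit.
Unset Printing Implicit Defensive.

Import Order.TTheory GRing.Theory Num.Theory.
Import numFieldNormedType.Exports.

Local Open Scope classical_set_scope.
Local Open Scope ring_scope.

(** * Avoidance probabilities of an upward skip-free kernel *)

Section Avoidance.
Variables (R : realType) (Q : nat -> nat -> R).

(** The one-step operator of a kernel that jumps up by at most 1: the finite sum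
    is the whole expectation of [w] after one step from [j]. *)
Definition step (w : nat -> R) (j : nat) : R := \sum_(k < j.+2) Q j k * w k.

Definition step_avoiding (i : nat) (w : nat -> R) : nat -> R :=
  step (fun k => if k == i then 0 else w k).

(** The probability, for a chain started at [j], of not being at [i] at any of
    the times 1, ..., n; the starting point itself may be [i]. *)
Definition avoid (i n : nat) : nat -> R := iter n (step_avoiding i) (fun=> 1).

Hypothesis Q_ge0 : forall j k, 0 <= Q j k.
Hypothesis Q_sum1 : forall j, \sum_(k < j.+2) Q j k = 1.

Lemma step_le (v w : nat -> R) :
  (forall k, v k <= w k) -> forall j, step v j <= step w j.
Proof. by move=> vw j; apply: ler_sum => k _; rewrite ler_wpM2l. Qed.

Lemma step_avoiding_le i (v w : nat -> R) :
  (forall k, v k <= w k) -> forall j, step_avoiding i v j <= step_avoiding i w j.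
Proof. by move=> vw; apply: step_le => k; case: ifP. Qed.

Lemma avoid_ge0 i n j : 0 <= avoid i n j.
Proof.
elim: n j => [|n IH] j; first exact: ler01.
by apply: sumr_ge0 => k _; rewrite mulr_ge0 //; case: ifP.
Qed.

Lemma avoid_decr i n j : avoid i n.+1 j <= avoid i n j.
Proof.
elim: n j => [|n IH] j; last exact: step_avoiding_le IH j.
rewrite -[leRHS](Q_sum1 j); apply: ler_sum => k _.
by rewrite ler_piMr //; case: ifP.
Qed.

Lemma avoid_le1 i n j : avoid i n j <= 1.
Proof. by elim: n => [//|n]; apply: le_trans (avoid_decr i n j). Qed.

Lemma avoid_cvg i j : avoid i ^~ j @ \oo --> limn (avoid i ^~ j).
Proof.
apply: nonincreasing_is_cvgn; last first.
  by exists 0 => _ [n _ <-]; exact: avoid_ge0.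
by apply/nonincreasing_seqP => n; exact: avoid_decr.
Qed.

(** If bounded subharmonic functions are constant, then a chain started at [i]
    returns to [i] almost surely.  The limit [u] of the avoidance probabilities
    is the expectation after one step of [w], the function [u] reset to 0 at [i].
    Since [w <= u], this [w] is subharmonic; being constant and 0 at [i], it
    vanishes. *)
Lemma avoid_cvg0 i :
  (forall w : nat -> R, (forall j, 0 <= w j <= 1) ->
     (forall j, w j <= step w j) -> forall j k, w j = w k) ->
  avoid i ^~ i @ \oo --> 0.
Proof.
move=> liouville.
pose u j := limn (avoid i ^~ j).
have u_ge0 j : 0 <= u j.
  by apply: limr_ge; [exact: avoid_cvg | near=> n; exact: avoid_ge0].
have u_le1 j : u j <= 1.
  by apply: limr_le; [exact: avoid_cvg | near=> n; exact: avoid_le1].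
have u_fix j : u j = step_avoiding i u j.
  apply: (@cvg_unique _ _ (avoid i n.+1 j @[n --> \oo])) => //.
    by have := @avoid_cvg i j; rewrite -(cvg_shiftS (avoid i ^~ j)).
  pose a n k := Q j k * (if k == i then 0 else avoid i n k).
  rewrite /step_avoiding /step -[X in nbhs X]/(\sum_(k < j.+2) a n k @[n --> \oo]).
  apply: cvg_big; first exact: add_continuous.
  move=> k _; apply: cvgMl_tmp.
  by case: ifP => _; [exact: cvg_cst | exact: avoid_cvg].
pose w k := if k == i then 0 else u k.
have w0 j : w j = 0.
  rewrite (liouville w _ _ j i) /w ?eqxx // => k.
  - by case: ifP => _; rewrite ?lexx ?ler01 ?u_ge0 ?u_le1.
  - by rewrite -[leRHS]u_fix; case: ifP.
have <- : u i = 0; last exact: avoid_cvg.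
by rewrite u_fix; apply: big1 => k _; rewrite -[X in _ * X]/(w k) w0 mulr0.
Unshelve. all: by end_near.
Qed.

End Avoidance.

(** * From avoidance probabilities to recurrence *)

Section PathAvoidance.
Context d (T : measurableType d) (R : realType) (P : probability T R).
Variables (X : nat -> {RV P >-> nat}).

Definition past (n : nat) (x : nat -> nat) : set T :=
  [set t | forall k : nat, (k <= n)%N -> X k t = x k].

Definition avoids (i m n : nat) : set T :=
  [set t | forall k, (0 < k <= n)%N -> X (m + k)%N t != i].

Lemma measurable_state (m : nat) (A : set nat) : measurable [set t | A (X m t)].
Proof. exact: (measurable_funPTI (X m)). Qed.

Lemma measurable_past n x : measurable (past n x).
Proof.
rewrite (_ : past n x = \bigcap_(k in [set k | (k <= n)%N]) [set t | X k t = x k]) //.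
by apply: bigcap_measurableType => k _; exact: (measurable_state k [set x k]).
Qed.

Lemma measurable_avoids i m n : measurable (avoids i m n).
Proof.
rewrite (_ : avoids i m n = \bigcap_(k in [set k | (0 < k <= n)%N])
  [set t | X (m + k)%N t != i]) //.
by apply: bigcap_measurableType => k _; exact: (measurable_state _ [set y | y != i]).
Qed.

Definition extend (x : nat -> nat) (m j : nat) : nat -> nat :=
  fun k => if (k <= m)%N then x k else j.

Lemma past_extend x m j : past m.+1 (extend x m j) = past m x `&` [set t | X m.+1 t = j].
Proof.
apply/seteqP; split => t /=.
  move=> xt; split; last by rewrite xt // /extend ltnn.
  by move=> k km; rewrite xt ?leqW // /extend km.
move=> [xt Xj] k; rewrite leq_eqVlt ltnS => /predU1P[->|km].
  by rewrite /extend ltnn.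
by rewrite /extend km xt.
Qed.

(** There are only countably many possible pasts up to time [m], so an event
    that is null on each of them is null. *)
Lemma null_of_pasts (m : nat) (B : set T) : measurable B ->
  (forall x, P (past m x `&` B) = 0%E) -> P B = 0%E.
Proof.
move=> mB H.
(* Paths are enumerated as the [pickle] codes of sequences of states; integers
   that are not codes give the constant path 0. *)
pose x_ n := nth 0%N (odflt [::] (unpickle n) : seq nat).
have sub : B `<=` \bigcup_n (past m (x_ n) `&` B).
  move=> t Bt; exists (pickle [seq X k t | k <- iota 0 m.+1]) => //; split => // k km.
  by rewrite /x_ pickleK /= -[RHS]/(nth 0%N [seq X k t | k <- iota 0 m.+1] k)
    (nth_map 0%N) ?size_iota ?nth_iota ?ltnS.
apply: measure_negligible => //; apply: negligibleS sub _.
apply: negligible_bigcup => n; apply/negligibleP; last exact: H.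
by apply: measurableI => //; exact: measurable_past.
Qed.

Variables (i0 : nat) (Q : nat -> nat -> R).
Hypothesis hX : markov_chain X i0 Q.

(** The Markov property in product form.  It also holds for null pasts, where
    the conditional probability says nothing. *)
Lemma past_extend_pr x m j :
  P (past m.+1 (extend x m j)) = (P (past m x) * (Q (x m) j)%:E)%E.
Proof.
have mp := measurable_past m x.
have mj : measurable [set t | X m.+1 t = j] by exact: (measurable_state _ [set j]).
rewrite past_extend; have [p0|p0] := eqVneq (P (past m x)) 0%E.
  rewrite p0 mul0e; apply: (subset_measure0 _ mp) => //; exact: measurableI.
have pgt : (0 < P (past m x))%E by rewrite lt0e p0 measure_ge0.
have := hX.2 m x j pgt; rewrite /cond_pr -/(past m x) => <-.
have fin : fine (P (past m x)) != 0 by rewrite fine_eq0 // fin_num_measure.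
rewrite -[X in (X * _)%E]fineK ?fin_num_measure // -EFinM mulrC divfK //.
by rewrite fineK ?fin_num_measure 1?setIC //; exact: measurableI.
Qed.

Hypothesis Q_ge0 : forall j k, 0 <= Q j k.
Hypothesis Q_up : forall j k, (j.+1 < k)%N -> Q j k = 0.

(** By induction on [n], splitting over the next state: countable subadditivity
    and the product form of the Markov property give one step of [avoid]. *)
Lemma past_avoids_le i n m x :
  (P (past m x `&` avoids i m n) <= P (past m x) * (avoid Q i n (x m))%:E)%E.
Proof.
elim: n m x => [|n IH] m x.
  rewrite mule1; apply: le_measure; rewrite ?inE; last exact: subIsetl.
    by apply: measurableI; [exact: measurable_past|exact: measurable_avoids].
  exact: measurable_past.
pose F j := if j == i then set0 else past m.+1 (extend x m j) `&` avoids i m.+1 n.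
have mF j : measurable (F j).
  rewrite /F; case: ifP => // _.
  by apply: measurableI; [exact: measurable_past|exact: measurable_avoids].
have sub : past m x `&` avoids i m n.+1 `<=` \bigcup_j F j.
  move=> t [xt at_]; exists (X m.+1 t) => //; rewrite /F.
  have := at_ 1%N isT; rewrite addn1 => /negbTE ->; split.
    by rewrite past_extend.
  by move=> k /andP[k0 kn]; rewrite addSnnS; exact: at_.
apply: le_trans (measure_sigma_subadditive P mF _ sub) _.
  by apply: measurableI; [exact: measurable_past|exact: measurable_avoids].
pose w k := if k == i then 0 else avoid Q i n k.
have PF j : (P (F j) <= P (past m x) * (Q (x m) j * w j)%:E)%E.
  rewrite /F /w; case: ifP => _; first by rewrite measure0 mulr0 mule0.
  apply: le_trans (IH _ _) _.
  by rewrite past_extend_pr /extend ltnn EFinM muleA.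
(* States above [x m + 1] cannot be reached in one step, so the series is the
   finite sum in the definition of [step]. *)
rewrite (nneseries_split 0 (x m).+2) ?add0n; last by move=> *; exact: measure_ge0.
rewrite [X in (_ + X)%E]eseries0 ?adde0; last first.
  move=> k xk _; apply/eqP; rewrite eq_le measure_ge0 andbT.
  by apply: le_trans (PF k) _; rewrite Q_up ?mul0r ?mule0.
rewrite big_mkord /avoid iterS /step_avoiding /step -/(avoid Q i n).
rewrite -sumEFin ge0_sume_distrr; last first.
  by move=> k _; rewrite lee_fin mulr_ge0 //; case: ifP => // _; exact: avoid_ge0.
by apply: lee_sum => k _; exact: PF.
Qed.

Lemma recurrent_state_of_avoid i :
  avoid Q i ^~ i @ \oo --> 0 -> recurrent_state X i.
Proof.
move=> av0 m mi0.
set ret := [set t | exists2 n : nat, _ & _]; set Xi := [set t | X m t = i].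
pose never := \bigcap_n avoids i m n.
have mnever : measurable never.
  by apply: bigcapT_measurable => n; exact: measurable_avoids.
have mXi : measurable Xi by exact: (measurable_state m [set i]).
have null : P (never `&` Xi) = 0%E.
  apply: (@null_of_pasts m); first exact: measurableI.
  move=> x.
  have mpx : measurable (past m x `&` (never `&` Xi)).
    by apply: measurableI; [exact: measurable_past | exact: measurableI].
  have [xi|xi] := eqVneq (x m) i; last first.
    rewrite (_ : _ `&` _ = set0) ?measure0 // -subset0 => t [xt [_ Xit]].
    by move/eqP: xi; apply; rewrite -xt.
  have bnd n : (P (past m x `&` (never `&` Xi)) <= (avoid Q i n i)%:E)%E.
    apply: (@le_trans _ _ (P (past m x `&` avoids i m n))).
      apply: le_measure; rewrite ?inE //.
        by apply: measurableI; [exact: measurable_past|exact: measurable_avoids].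
      by move=> t [xt [nt _]]; split => //; exact: nt.
    apply: le_trans (past_avoids_le _ _ _ _) _; rewrite xi.
    rewrite -[leRHS]mul1e; apply: lee_wpmul2r; first by rewrite lee_fin avoid_ge0.
    exact/probability_le1/measurable_past.
  apply/eqP; rewrite eq_le measure_ge0 andbT.
  rewrite -[X in (X <= _)%E]fineK ?fin_num_measure // lee_fin.
  rewrite -(cvg_lim (@Rhausdorff R) av0); apply: limr_ge.
    by apply/cvg_ex; exists 0.
  by near=> n; rewrite -lee_fin fineK ?fin_num_measure.
have retE : ret `&` Xi = Xi `\` (never `&` Xi).
  apply/seteqP; split => t [] /=.
    move=> [n n0 Xn] Xit; split => // -[nv _].
    by have /eqP := nv n I n (introT andP (conj n0 (leqnn n))).
  move=> Xit nnv; split => //; apply: contrapT => nr; apply: nnv; split => // n _ k.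
  by move=> /andP[k0 _]; apply/eqP => Xk; apply: nr; exists k.
rewrite /cond_pr retE measureD //; last by rewrite ltey_eq fin_num_measure.
  rewrite setIA setIAC setIid setIC [X in (_ - X)%E](_ : _ = 0%E); last exact: null.
  rewrite sube0 divff // fine_eq0 ?fin_num_measure //.
  by rewrite gt_eqF.
exact: measurableI.
Unshelve. all: by end_near.
Qed.

End PathAvoidance.

(** * The harmonic function of the walk *)

Section Walk21Liouville.
Variables (R : realType) (p q1 q2 : nat -> R).
Hypothesis hpq : params21 p q1 q2.

Local Notation Q := (trans21 p q1 q2).

Lemma trans21_ge0 j k : 0 <= Q j k.
Proof.
case: j => [|[|j]] /=.
- by case: ifP.
- have [q1_ge0 q2_ge0 /andP[/ltW p_ge0 _] _] := hpq (leqnn 1).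
  by case: ifP => // _; case: ifP => // _; rewrite addr_ge0.
- have [q1_ge0 q2_ge0 /andP[/ltW p_ge0 _] _] := hpq (ltn0Sn j.+1).
  by do 3 (case: ifP => // _).
Qed.

Lemma trans21_up j k : (j.+1 < k)%N -> Q j k = 0.
Proof.
by case: j => [|[|j]] /= jk; rewrite !ifN_eq //; apply/eqP; lia.
Qed.

Lemma trans21_step0 w : step Q w 0 = w 1%N.
Proof. by rewrite /step !big_ord_recr big_ord0 /= mul0r !add0r mul1r. Qed.

Lemma trans21_step1 w : step Q w 1 = p 1%N * w 2 + (q1 1%N + q2 1%N) * w 0%N.
Proof. by rewrite /step !big_ord_recr big_ord0 /= mul0r add0r addr0 addrC. Qed.

Lemma trans21_step j w :
  step Q w j.+2 = p j.+2 * w j.+3 + q1 j.+2 * w j.+1 + q2 j.+2 * w j.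
Proof.
rewrite /step !big_ord_recr big1 /= => [|k _]; last first.
  by have kj := ltn_ord k; rewrite !ifN_eq ?mul0r //; apply/eqP; lia.
by rewrite !eqxx; do 6 (rewrite ifN_eq; last by apply/eqP; lia); rewrite mul0r; ring.
Qed.

Lemma trans21_sum1 j : \sum_(k < j.+2) Q j k = 1.
Proof.
transitivity (step Q (fun=> 1) j); first by apply: eq_bigr => k _; rewrite mulr1.
case: j => [|[|j]]; first by rewrite trans21_step0.
- have [_ _ _ s] := hpq (leqnn 1); rewrite trans21_step1; lra.
- have [_ _ _ s] := hpq (ltn0Sn j.+1); rewrite trans21_step; lra.
Qed.

(** The increment h(k+1) - h(k) of the function h described at the top.  The
    empty matrix product makes [hincr 0 = 1]. *)
Definition hincr (k : nat) : R := (vec_e1 R *m walkMprod p q1 q2 k *m vec_u R) 0 0.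

Lemma walkMprodS k :
  walkMprod p q1 q2 k.+1 = walkM p q1 q2 k.+1 *m walkMprod p q1 q2 k.
Proof.
by rewrite /walkMprod big_nat_recl // subn0; congr (_ * _).
Qed.

Definition wcol k : 'cV[R]_2 := walkMprod p q1 q2 k *m vec_u R.

Lemma hincrE k : hincr k = wcol k 0 0.
Proof. by rewrite /hincr -mulmxA -rowE mxE. Qed.

Lemma wcol0 i : wcol 0 i 0 = 1.
Proof.
rewrite /wcol /walkMprod big_nil mul1mx !mxE /= -val_eqE /=.
by case: i => -[|[|//]] ? /=; rewrite ?addr0 ?add0r.
Qed.

Lemma wcolS k : wcol k.+1 = walkM p q1 q2 k.+1 *m wcol k.
Proof. by rewrite /wcol walkMprodS mulmxA. Qed.

Lemma mulmx2_fst (a b c e : R) (v : 'cV_2) :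
  (mx2 a b c e *m v) 0 0 = a * v 0 0 + b * v 1 0.
Proof.
rewrite mxE big_ord_recl big_ord1 !mxE /=.
by rewrite (_ : lift ord0 ord0 = 1) //; exact: val_inj.
Qed.

Lemma mulmx2_snd (a b c e : R) (v : 'cV_2) :
  (mx2 a b c e *m v) 1 0 = c * v 0 0 + e * v 1 0.
Proof.
rewrite mxE big_ord_recl big_ord1 !mxE /=.
by rewrite (_ : lift ord0 ord0 = 1) //; exact: val_inj.
Qed.

Lemma hincr0 : hincr 0 = 1.
Proof. by rewrite hincrE wcol0. Qed.

(** Harmonicity of h at 1, written with increments. *)
Lemma hincr1 : p 1%N * hincr 1 = q1 1%N + q2 1%N.
Proof.
have [_ _ /andP[p0 _] _] := hpq (leqnn 1).
rewrite hincrE wcolS mulmx2_fst !wcol0.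
by field; rewrite gt_eqF.
Qed.

(** The second coordinate of M_k ... M_1 u carries the previous increment, which
    is how a product of matrices of size 2 encodes a recursion of order two. *)
Lemma wcol_snd k : wcol k.+1 1 0 = hincr k + hincr k.+1.
Proof.
rewrite !hincrE wcolS; case: k => [|k].
  have [_ _ /andP[p0 _] s] := hpq (leqnn 1).
  rewrite mulmx2_fst mulmx2_snd !wcol0 -s.
  by field; rewrite gt_eqF.
by rewrite mulmx2_fst mulmx2_snd; ring.
Qed.

(** Harmonicity of h at k + 2, written with increments: a jump of size 2
    downwards crosses two of them. *)
Lemma hincrS k : p k.+2 * hincr k.+2 =
  (q1 k.+2 + q2 k.+2) * hincr k.+1 + q2 k.+2 * hincr k.
Proof.
have [_ _ /andP[p0 _] _] := hpq (ltn0Sn k.+1).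
rewrite hincrE wcolS mulmx2_fst wcol_snd -hincrE.
by field; rewrite gt_eqF.
Qed.

Lemma hincr_gt0 k : 0 < hincr k.
Proof.
elim/ltn_ind: k => -[_|[_|k IH]]; first by rewrite hincr0.
- have [? ? /andP[p0 ?] ?] := hpq (leqnn 1).
  rewrite -(pmulr_rgt0 _ p0) hincr1; lra.
- have [? ? /andP[p0 ?] ?] := hpq (ltn0Sn k.+1).
  rewrite -(pmulr_rgt0 _ p0) hincrS.
  have ? : 0 < q1 k.+2 + q2 k.+2 by lra.
  by rewrite ltr_wpDr ?mulr_ge0 ?mulr_gt0 ?IH // ltW // IH.
Qed.

Lemma hincr_sum_unbounded (B : R) : kappa p q1 q2 = +oo%E ->
  exists n, B < \sum_(0 <= k < n) hincr k.
Proof.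
move=> kap; apply: contrapT => /forallNP bnd.
suff : (kappa p q1 q2 <= B%:E)%E by rewrite kap.
rewrite /kappa; apply: lime_le.
  by apply: is_cvg_nneseries => k _ _; rewrite lee_fin ltW // hincr_gt0.
near=> n; have /negP := bnd n; rewrite -leNgt => nB.
rewrite sumEFin lee_fin; apply: le_trans nB.
have n0 : (0 < n)%N by near: n; exact: nbhs_infty_gt.
by rewrite [leRHS]big_ltn // lerDr ltW // hincr_gt0.
Unshelve. all: by end_near.
Qed.

(** * Bounded subharmonic functions of the walk *)

Section Subharmonic.
Variable w : nat -> R.
Hypothesis sub : forall j, w j <= step Q w j.

(** The increments of [w] satisfy the recursion [hincrS] as an inequality, with
    nonnegative coefficients, so a lower bound by a multiple of [hincr] at two
    consecutive states propagates upwards. *)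
Lemma subharmonic_incr c j :
  c * hincr j <= w j.+1 - w j -> c * hincr j.+1 <= w j.+2 - w j.+1 ->
  forall n, (j <= n)%N -> c * hincr n <= w n.+1 - w n.
Proof.
move=> cj cj1.
suff H n : c * hincr (j + n) <= w (j + n).+1 - w (j + n)%N /\
    c * hincr (j + n).+1 <= w (j + n).+2 - w (j + n).+1.
  by move=> n jn; have := (H (n - j)%N).1; rewrite subnKC.
elim: n => [|n [IH1 IH2]]; first by rewrite addn0.
rewrite addnS; split => //; set k := (j + n)%N in IH1 IH2 *.
have [? q2k /andP[p0 ?] s] := hpq (ltn0Sn k.+1).
have hk := hincrS k.
have := sub k.+2; rewrite trans21_step => wk.
rewrite -(ler_pM2l p0) mulrCA hk.
have q12k : 0 <= q1 k.+2 + q2 k.+2 by lra.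
have := ler_wpM2l q12k IH2; have := ler_wpM2l q2k IH1.
have : p k.+2 = 1 - q1 k.+2 - q2 k.+2 by lra.
move: wk => /[swap] ->; lra.
Qed.

Hypothesis unbounded : forall B : R, exists n, B < \sum_(0 <= k < n) hincr k.
Hypothesis w01 : forall j, 0 <= w j <= 1.

(** If [c] were positive, [w] would grow at least like a positive multiple of h. *)
Lemma bounded_subharmonic_incr c j :
  c * hincr j <= w j.+1 - w j -> c * hincr j.+1 <= w j.+2 - w j.+1 -> c <= 0.
Proof.
move=> cj cj1; rewrite leNgt; apply/negP => c0.
have H := subharmonic_incr cj cj1.
have [n] := unbounded (\sum_(0 <= k < j) hincr k + c^-1).
have [nj|/ltnW jn] := leqP n j.
  apply/negP; rewrite -leNgt (big_cat_nat _ nj) //= -addrA lerDl.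
  by rewrite addr_ge0 ?invr_ge0 ?(ltW c0) // sumr_ge0 // => k _; rewrite ltW // hincr_gt0.
apply/negP; rewrite -leNgt (big_cat_nat _ jn) //= lerD2l.
rewrite -(ler_pM2l c0) divff ?gt_eqF // mulr_sumr.
apply: (@le_trans _ _ (\sum_(j <= k < n) (w k.+1 - w k))).
  by apply: ler_sum_nat => k /andP[/H].
rewrite telescope_sumr //; have := w01 n; have := w01 j; lra.
Qed.

Lemma bounded_subharmonic_const j k : w j = w k.
Proof.
have w10 : w 0%N <= w 1%N by rewrite -trans21_step0.
have [? ? /andP[p1 ?] s1] := hpq (leqnn 1).
have w1 := sub 1; rewrite trans21_step1 in w1.
have h1 := hincr1.
(* At 1 the walk can only go down to 0, so one increment starts the comparison. *)
have incr0 : w 1%N - w 0%N <= 0.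
  apply: (@bounded_subharmonic_incr _ 0); first by rewrite hincr0 mulr1.
  rewrite -(ler_pM2l p1) mulrCA h1; nra.
(* The comparison with the multiple 0 of h propagates the sign. *)
have incr_ge0 n : 0 <= w n.+1 - w n.
  have := @subharmonic_incr 0 0; rewrite !mul0r => /(_ _ _ n isT).
  rewrite mul0r; apply; first by rewrite subr_ge0.
  rewrite -(pmulr_rge0 _ p1); nra.
have incrE n : w n.+1 - w n = 0.
  apply/eqP; rewrite eq_le incr_ge0 andbT leNgt; apply/negP => wn.
  have wn1 : 0 < w n.+2 - w n.+1.
    case: n wn => [|n] wn; first by move: (lt_le_trans wn incr0); rewrite ltxx.
    have [? ? /andP[p0 ?] s] := hpq (ltn0Sn n.+1).
    have := sub n.+2; rewrite trans21_step => wn2; have := incr_ge0 n => wn0.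
    rewrite -(pmulr_rgt0 _ p0).
    have : 0 <= q2 n.+2 * (w n.+1 - w n) by rewrite mulr_ge0.
    have : 0 < (q1 n.+2 + q2 n.+2) * (w n.+2 - w n.+1) by rewrite mulr_gt0 //; lra.
    have : p n.+2 = 1 - q1 n.+2 - q2 n.+2 by lra.
    move: wn2 => /[swap] ->; lra.
  have h0 := hincr_gt0.
  (* The largest multiple of h that lies below [w] at both increments. *)
  suff : Num.min ((w n.+1 - w n) / hincr n) ((w n.+2 - w n.+1) / hincr n.+1) <= 0.
    by apply/negP; rewrite -ltNge lt_min !divr_gt0.
  by apply: (@bounded_subharmonic_incr _ n); rewrite -ler_pdivlMr // ge_min lexx ?orbT.
suff H n : w n = w 0%N by rewrite !H.
by elim: n => // n <-; apply/eqP; rewrite -subr_eq0 incrE.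
Qed.

End Subharmonic.

End Walk21Liouville.

Theorem theorem1p1 (R : realType) (p q1 q2 : nat -> R)
    (hpq : params21 p q1 q2)
    (d : measure_display) (T : measurableType d) (P : probability T R)
    (X : nat -> {RV P >-> nat})
    (hX : reflecting_walk21 p q1 q2 X)
    (hkappa : kappa p q1 q2 = (+oo)%E) :
  recurrent X.
Proof.
have Q_ge0 := trans21_ge0 hpq.
move=> i; apply: (recurrent_state_of_avoid hX Q_ge0 (@trans21_up _ p q1 q2)).
apply: (avoid_cvg0 Q_ge0 (trans21_sum1 hpq)) => w w01 sub j k.
apply: (bounded_subharmonic_const hpq sub _ w01) => B.
exact: hincr_sum_unbounded.
Qed.
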